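(* Let $\lambda\in\mathbb{R}$. For every integer $n\ge 0$, \[ \mathrm{Bel}_{n+1,\lambda}(x)= x\sum_{m=0}^{n}\binom{n}{m}\mathrm{Bel}_{m,\lambda}(x)\,(1)_{n-m+1,\lambda}. \]
   Context: For $\lambda\in\mathbb{R}$, $(x)_{0,\lambda}=1$ and $(x)_{n,\lambda}=x(x-\lambda)\cdots(x-(n-1)\lambda)$ for $n\ge1$. The degenerate exponential is $e_\lambda(t)=\sum_{k\ge0}(1)_{k,\lambda}t^k/k!$ (equal to $(1+\lambda t)^{1/\lambda}$ for $\lambda\ne0$, $e^t$ for $\lambda=0$). The degenerate Bell polynomials are defined by $e^{x(e_{\lambda}(t)-1)}=\sum_{n=0}^{\infty}\mathrm{Bel}_{n,\lambda}(x)\frac{t^{n}}{n!}$. *)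

(* Defs.v *)
From mathcomp Require Import all_boot all_order all_algebra.
From mathcomp Require Import reals.
Set Implicit Arguments.
Unset Strict Implicit.
Unset Printing Implicit Defensive.
Import Order.TTheory GRing.Theory Num.Theory.
Local Open Scope ring_scope.

(* The generating functions are read as identities between formal power series
   in t.  A series \sum_n a_n t^n is represented by its coefficient sequence
   n |-> a_n; no factorial is built into the encoding. *)
Definition fps (A : Type) := nat -> A.

Section FormalPowerSeries.
Variable A : nzRingType.
Implicit Types f g : fps A.

Definition fps_const (c : A) : fps A := fun n => if n is 0 then c else 0.
Definition fps_sub f g : fps A := fun n => f n - g n.
Definition fps_scale (c : A) f : fps A := fun n => c * f n.
Definition fps_mul f g : fps A := fun n => \sum_(i < n.+1) f i * g (n - i)%N.
Definition fps_pow f k : fps A := iter k (fps_mul f) (fps_const 1).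

Lemma fps_pow_low f k n : f 0%N = 0 -> (n < k)%N -> fps_pow f k n = 0.
Proof.
move=> f0; elim: k n => [|k IHk] n // lt_nk.
rewrite /fps_pow iterS -/(fps_pow f k) /fps_mul big_ord_recl f0 mul0r add0r.
apply: big1 => i _; rewrite IHk ?mulr0 //=.
by apply: leq_trans (_ : n <= k)%N; rewrite // ltn_subrL /= (leq_trans _ (ltn_ord i)).
Qed.

End FormalPowerSeries.

Section Exponential.
Variables (R : fieldType) (A : lalgType R).

(* For f with zero constant term, exp(f) = \sum_k f^k / k!; the coefficient of
   t^n only receives contributions from k <= n, cf. fps_exp_trunc.  It is
   meaningful only for such f. *)
Definition fps_exp (f : fps A) : fps A :=
  fun n => \sum_(k < n.+1) (k`!%:R^-1 : R) *: fps_pow f k n.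

Lemma fps_exp_trunc (f : fps A) n N : f 0%N = 0 -> (n < N)%N ->
  \sum_(k < N) (k`!%:R^-1 : R) *: fps_pow f k n = fps_exp f n.
Proof.
move=> f0 lt_nN; rewrite /fps_exp -!(big_mkord xpredT
  (fun k => (k`!%:R^-1 : R) *: fps_pow f k n)) (big_cat_nat (n := n.+1)) //=.
rewrite [X in _ + X]big_nat_cond [X in _ + X]big1 ?addr0 // => k.
by rewrite andbT => /andP[lt_nk _]; rewrite fps_pow_low ?scaler0.
Qed.

(* The series \sum_n a_n t^n / n!. *)
Definition egf (a : nat -> A) : fps A := fun n => (n`!%:R^-1 : R) *: a n.

End Exponential.

Section DegenerateBell.
Variable R : realType.
Implicit Types lam x : R.

(* (x)_{n,lam} = x (x - lam) ... (x - (n - 1) lam) *)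
Definition dff x lam n : R := \prod_(i < n) (x - i%:R * lam).

(* e_lam(t), with its real coefficients viewed as constant polynomials in x. *)
Definition dexp lam : fps {poly R} := egf (fun k => (dff 1 lam k)%:P).

(* exp(x (e_lam(t) - 1)) in R[x][[t]], where the indeterminate x is 'X. *)
Definition Bell_gf lam : fps {poly R} :=
  fps_exp (fps_scale 'X (fps_sub (dexp lam) (fps_const 1))).

(* Bel_{n,lam}(x), as a polynomial in x: n! times the coefficient of t^n, i.e.
   the unique sequence satisfying Bell_gfE and Bel_unique below. *)
Definition Bel lam n : {poly R} := n`!%:R *: Bell_gf lam n.

Lemma Bell_arg0 lam : fps_scale 'X (fps_sub (dexp lam) (fps_const 1)) 0%N = 0.
Proof.
by rewrite /fps_scale /fps_sub /dexp /egf /= /dff big_ord0 fact0 invr1 scale1r subrr mulr0.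
Qed.

Lemma Bell_gfE lam : Bell_gf lam =1 egf (Bel lam).
Proof.
move=> n; rewrite /egf /Bel scalerA mulVf ?scale1r //.
by rewrite pnatr_eq0 -lt0n fact_gt0.
Qed.

Lemma Bel_unique lam (b : nat -> {poly R}) :
  Bell_gf lam =1 egf b -> b =1 Bel lam.
Proof.
move=> bE n; rewrite /Bel bE /egf scalerA mulfV ?scale1r //.
by rewrite pnatr_eq0 -lt0n fact_gt0.
Qed.

End DegenerateBell.

(* Main.v *)
(* With F = exp f and f = x (e_lam(t) - 1), the recurrence is the identity
   F' = f' F read off at t^n / n!.  Chain rule and Leibniz rule for power series
   are inherited from {poly A}, since the coefficients of f^k up to t^n only
   depend on the truncation of f at that order. *)
Require Import Defs.
From mathcomp Require Import all_boot all_order all_algebra.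
From mathcomp Require Import reals.
Set Implicit Arguments.
Unset Strict Implicit.
Unset Printing Implicit Defensive.
Import Order.TTheory GRing.Theory Num.Theory.
Local Open Scope ring_scope.

Lemma fps_pow_trunc (A : nzRingType) (f : fps A) N k n :
  (n < N)%N -> fps_pow f k n = ((\poly_(i < N) f i) ^+ k)`_n.
Proof.
elim: k n => [|k IHk] n lt_nN; first by rewrite expr0 coef1; case: n lt_nN.
rewrite /fps_pow iterS -/(fps_pow f k) exprS coefM; apply: eq_bigr => i _.
have le_in : (i <= n)%N by rewrite -ltnS.
by rewrite coef_poly (leq_ltn_trans le_in) // IHk // (leq_ltn_trans (leq_subr _ _)).
Qed.

(** The coefficient of t^n in (f^(k+1))' = (k+1) f' f^k. *)
Lemma fps_pow_deriv (A : comNzRingType) (f : fps A) k n :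
  fps_pow f k.+1 n.+1 *+ n.+1 =
  (\sum_(i < n.+1) f (n - i).+1 *+ (n - i).+1 * fps_pow f k i) *+ k.+1.
Proof.
(* Order [n.+2] keeps the coefficient of t^(n+1), which differentiation moves to t^n. *)
rewrite (@fps_pow_trunc _ _ n.+2) // -coef_deriv deriv_exp coefMn
  coefMr; congr (_ *+ _); apply: eq_bigr => i _.
rewrite coef_deriv coef_poly ltnS (leq_ltn_trans (leq_subr _ _)) //.
by rewrite -fps_pow_trunc ?(leqW (ltn_ord i)).
Qed.

(** Termwise differentiation: (k+1)/(k+1)! = 1/k! turns the sum over k into f' exp(f). *)
Lemma fps_exp_deriv (R : numFieldType) (A : comAlgType R) (f : fps A) n :
  f 0%N = 0 ->
  fps_exp f n.+1 *+ n.+1 =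
  \sum_(i < n.+1) f (n - i).+1 *+ (n - i).+1 * fps_exp f i.
Proof.
move=> f0; rewrite {1}/fps_exp big_ord_recl -[fps_pow f ord0 _]/(0 : A) scaler0 add0r.
rewrite -sumrMnl.
(* Extending every inner sum to k <= n makes its range independent of [i], so the sums can be
   exchanged. *)
under [RHS]eq_bigr => i _ do
  rewrite -(fps_exp_trunc f0 (ltn_ord i)) mulr_sumr.
rewrite exchange_big; apply: eq_bigr => k _.
rewrite lift0 scalerMnr fps_pow_deriv -scalerMnr.
rewrite scalerMnl factS natrM invfM -mulr_natl mulVKf ?pnatr_eq0 //.
by rewrite scaler_sumr; apply: eq_bigr => i _; rewrite scalerAr.
Qed.

Theorem theorem5 (R : realType) (lam : R) (n : nat) :
  Bel lam n.+1 =
  'X * \sum_(m < n.+1)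
         'C(n, m)%:R * Bel lam m * (dff 1 lam (n - m + 1)%N)%:P.
Proof.
rewrite /Bel factS mulnC natrM -scalerA (scaler_nat n.+1) /Bell_gf.
rewrite (fps_exp_deriv n (Bell_arg0 lam)) -/(Bell_gf lam) mulr_sumr scaler_sumr.
apply: eq_bigr => m _; have le_mn : (m <= n)%N by rewrite -ltnS.
rewrite /fps_scale /fps_sub /dexp /egf /= subr0 addn1.
set d := (dff _ _ _)%:P; set g := Bell_gf lam m.
have fact_neq0 k : (k`!%:R : R) != 0 by rewrite pnatr_eq0 -lt0n fact_gt0.
have dE : (n - m).+1`!%:R^-1 *: d *+ (n - m).+1 = (n - m)`!%:R^-1 *: d.
  by rewrite scalerMnl factS natrM invfM -mulr_natl mulVKf ?pnatr_eq0.
(* n! = C(n,m) m! (n-m)!: m! turns [g] into [Bel lam m], and (n-m)! cancels the denominator in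
   [dE]. *)
rewrite -mulrnAr dE -(bin_fact le_mn) !natrM (mulr_natl (_ *: g)) -scaler_nat.
rewrite -!(scalerAl, scalerAr) !scalerA mulrA mulfK //.
by rewrite -mulrA (mulrC d).
Qed.
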